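(* Every odd integer $n > 24$ can be written as $n = p + m$, where $p$ is a prime and $m$ is a positive integer that is not square-free.
   Context: A positive integer is square-free if it is not divisible by $q^2$ for any prime $q$; it is not square-free if $q^2$ divides it for some prime $q$. *)

(* Defs.v *)
From mathcomp Require Import all_boot.

Set Implicit Arguments.
Unset Strict Implicit.
Unset Printing Implicit Defensive.

(* Meant for positive [m]: [0] is not square-free under this definition, so
   positivity has to be required separately wherever it matters. *)
Definition square_free (m : nat) : Prop :=
  forall q : nat, prime q -> ~~ (q ^ 2 %| m).

(* Main.v *)
Require Import Defs.
From mathcomp Require Import all_boot zify.

(** The square of the prime 2 always suffices: the primes 5 and 3 represent the
    two odd residue classes modulo 4, so one of [n - 5] and [n - 3] is a
    multiple of 4, and it is positive because [n] exceeds 5. *)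

Lemma dvd4_not_square_free (m : nat) : 4 %| m -> ~ square_free m.
Proof. by move=> dvd4m /(_ 2 isT); rewrite dvd4m. Qed.

Theorem theorem1p2 (n : nat) (n_odd : odd n) (n_gt24 : 24 < n) :
  exists p m : nat,
    [/\ prime p, 0 < m, ~ square_free m & n = p + m].
Proof.
have [n_mod4 | n_mod4] : n %% 4 = 1 \/ n %% 4 = 3 by lia.
- by exists 5, (n - 5); split=> //; [lia | apply: dvd4_not_square_free; lia | lia].
- by exists 3, (n - 3); split=> //; [lia | apply: dvd4_not_square_free; lia | lia].
Qed.
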